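(* Let $n\ge 1$, $\kappa\in\mathbb{N}^n$, and let $f,g\in\mathbb{C}[z_1,\ldots,z_n,w_1,\ldots,w_n]$ be of the form $$f(z,w)=\sum_{\alpha\le\kappa}\binom{\kappa}{\alpha}P_\alpha(w)z^\alpha,\qquad g(z,w)=\sum_{\alpha\le\kappa}\binom{\kappa}{\alpha}Q_\alpha(z)w^\alpha,$$ where $z=(z_1,\ldots,z_n)$, $w=(w_1,\ldots,w_n)$, and $P_\alpha\in\mathbb{C}[w_1,\ldots,w_n]$, $Q_\alpha\in\mathbb{C}[z_1,\ldots,z_n]$. (a) If $f$ and $g$ are $\mathbb{H}_\theta$-stable for some $0\le\theta<2\pi$, then the polynomial $$\sum_{\alpha\le\kappa}\binom{\kappa}{\alpha}P_\alpha(w)Q_{\kappa-\alpha}(z)=\frac{1}{\kappa!}\sum_{\alpha\le\kappa}\frac{\partial^\alpha f}{\partial z^\alpha}(0,w)\cdot\frac{\partial^{\kappa-\alpha}g}{\partial w^{\kappa-\alpha}}(z,0)$$ is $\mathbb{H}_\theta$-stable (in $2n$ variables) or identically zero. (b) If $f$ and $g$ are $\mathbb{D}$-stable, then the polynomial $$\sum_{\alpha\le\kappa}\binom{\kappa}{\alpha}P_\alpha(w)Q_{\alpha}(z)=\frac{1}{\kappa!}\sum_{\alpha\le\kappa}\frac{(\kappa-\alpha)!}{\alpha!}\cdot\frac{\partial^\alpha f}{\partial z^\alpha}(0,w)\cdot\frac{\partial^{\alpha}g}{\partial w^{\alpha}}(z,0)$$ is $\mathbb{D}$-stable (in $2n$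 variables) or identically zero.
   Context: $\mathbb{N}=\{0,1,2,\ldots\}$. $\mathbb{D}=\{\zeta\in\mathbb{C}:|\zeta|<1\}$ is the open unit disk, and for $\theta\in[0,2\pi)$, $\mathbb{H}_\theta=\{\zeta\in\mathbb{C}:\operatorname{Im}(e^{i\theta}\zeta)>0\}$. For $\Psi\subset\mathbb{C}$, a polynomial in $m$ complex variables is $\Psi$-stable if it does not vanish at any point of $\Psi^m$ (here $m=2n$). Multi-index notation: for $\alpha,\kappa\in\mathbb{N}^n$, $\alpha\le\kappa$ means $\alpha_i\le\kappa_i$ for all $i$; $z^\alpha=z_1^{\alpha_1}\cdots z_n^{\alpha_n}$; $\alpha!=\alpha_1!\cdots\alpha_n!$; $\binom{\kappa}{\alpha}=\prod_{i=1}^n\binom{\kappa_i}{\alpha_i}$; $\frac{\partial^\alpha}{\partial z^\alpha}=\frac{\partial^{\alpha_1+\cdots+\alpha_n}}{\partial z_1^{\alpha_1}\cdots\partial z_n^{\alpha_n}}$. Sums over $\alpha\le\kappa$ run over $\alpha\in\mathbb{N}^n$. *)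

(* Defs.v *)
From HB Require Import structures.
From mathcomp Require Import all_boot all_order all_algebra.
From mathcomp Require Import reals.
From mathcomp Require trigo.
From mathcomp Require Import complex mpoly.

Set Implicit Arguments.
Unset Strict Implicit.
Unset Printing Implicit Defensive.

Import Order.TTheory GRing.Theory Num.Theory.
Local Open Scope ring_scope.

Section Regions.
Variable R : realType.

Definition cis (theta : R) : R[i] :=
  Complex (trigo.cos theta) (trigo.sin theta).

Definition half_plane (theta : R) (x : R[i]) : Prop :=
  0 < complex.Im (cis theta * x).

(* The order of R[i] is partial; both sides of [`|x| < 1] are real here. *)
Definition unit_disk (x : R[i]) : Prop := `|x| < 1.

Definition stable (Psi : R[i] -> Prop) (m : nat) (p : {mpoly R[i][m]}) : Prop :=
  forall x : 'I_m -> R[i], (forall i, Psi (x i)) -> p.@[x] != 0.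

End Regions.

Section MultiIndices.
Variable n : nat.

Definition mfact (a : 'X_{1..n}) : nat := (\prod_(i < n) (a i)`!)%N.

Definition mbinom (k a : 'X_{1..n}) : nat := (\prod_(i < n) 'C(k i, a i))%N.

(* Of the n + n variables, the first n (via [lshift]) are z_1, ..., z_n and the
   last n (via [rshift]) are w_1, ..., w_n. [zexp a] is the exponent of z^a, and
   [wexp a] that of w^a. *)
Definition zexp (a : 'X_{1..n}) : 'X_{1..n + n} :=
  [multinom (if split i is inl j then a j else 0%N) | i < n + n].

Definition wexp (a : 'X_{1..n}) : 'X_{1..n + n} :=
  [multinom (if split i is inr j then a j else 0%N) | i < n + n].

End MultiIndices.

Section Variables.
Variables (R : realType) (n : nat).
Implicit Types (p : {mpoly R[i][n]}) (f : {mpoly R[i][n + n]}).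

(* p(z) and p(w), for a polynomial p in n variables *)
Definition in_z p : {mpoly R[i][n + n]} :=
  p \mPo [tuple 'X_(lshift n i) | i < n].

Definition in_w p : {mpoly R[i][n + n]} :=
  p \mPo [tuple 'X_(rshift n i) | i < n].

(* f(0, w) and f(z, 0), still regarded as polynomials in all n + n variables *)
Definition at_z0 f : {mpoly R[i][n + n]} :=
  f \mPo [tuple (if split i is inr _ then 'X_i else 0) | i < n + n].

Definition at_w0 f : {mpoly R[i][n + n]} :=
  f \mPo [tuple (if split i is inl _ then 'X_i else 0) | i < n + n].

(* The sum of F a over all a <= k: since a <= k forces |a| <= |k|, nothing is
   lost by letting a range over the finite type of multi-indices with
   |a| < |k| + 1. *)
Definition msum_le (k : 'X_{1..n}) (F : 'X_{1..n} -> {mpoly R[i][n + n]}) :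
    {mpoly R[i][n + n]} :=
  \sum_(a : 'X_{1..n < (mdeg k).+1} | (bmnm a <= k)%MM) F a.

End Variables.

(* Main.v *)
(* For a polynomial p of degree at most k without zeros in a disk or a half-plane
   Psi, Laguerre's theorem says that k p(u) + (v - u) p'(u) is nonzero for u, v in
   Psi; that is, one of the k arguments of the polar form of p may be moved away
   from the diagonal.

   Write f(z, w0) g(z0, w) as c(prod_i (1 + z_i S_i)^k_i (1 + w_i T_i)^k_i), where
   c is the linear functional on C[S, T] which sends S^a T^b to P_a(w0) Q_b(z0).
   Splitting off one factor 1 + u S and one factor 1 + v T, and applying Laguerre's
   theorem to the quadratic polynomial c((1 + x S)(1 + x T)), these two factors may
   be replaced by the contractor 2 + (t + s)(S + T) + 2 t s S T, for any t, s in
   Psi. In the end c(prod_i contractor_i^k_i) is nonzero. When t and s tend to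
   boundary points (0 and infinity for a half-plane, +i and -i for the disk), the
   contractor tends, up to a factor, to S + T, resp. to 1 + S T, whose powers yield
   the two polynomials of the theorem. By Hurwitz' theorem, a limit of stable
   polynomials is stable or zero. *)
Require Import Defs.
From HB Require Import structures.
From mathcomp Require Import all_boot all_order all_algebra.
From mathcomp Require Import reals.
From mathcomp Require trigo.
From mathcomp Require Import complex mpoly.
From mathcomp Require Import ring zify.

Set Implicit Arguments.
Unset Strict Implicit.
Unset Printing Implicit Defensive.

Import Order.TTheory GRing.Theory Num.Theory.
Local Open Scope ring_scope.

(** * Laguerre's theorem *)

Section Laguerre.
Variable C : numClosedFieldType.
Implicit Types (Psi : C -> Prop) (p : {poly C}).

(** The Hermitian equation of a circle or a line; [y + y^*] is twice the real part of [y]. *)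
Definition circle_form (a b c x : C) : C :=
  a + (b * x + (b * x)^*) - c * (x * x^*).

(* With [0 <= c], this covers open disks and open half-planes, but not
   complements of disks: polar derivatives of a polynomial of smaller degree
   have a root at infinity, which has to lie outside of the region. *)
Definition convex_circular Psi : Prop :=
  exists a b c : C, [/\ a \is Num.real, 0 <= c &
    forall x, Psi x <-> 0 < circle_form a b c x].

(** The order of [C] is partial: realness is what lets the failure of [0 < _] be read as
    [_ <= 0]. *)
Lemma circle_form_real a b c x :
  a \is Num.real -> 0 <= c -> circle_form a b c x \is Num.real.
Proof.
move=> ra c0; apply: realB.
  by apply: realD => //; apply/CrealP; rewrite rmorphD /= conjCK addrC.
by apply: realM; [exact: ger0_real | rewrite -normCK ger0_real ?exprn_ge0].
Qed.

Lemma circle_formB a b c u d :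
  c \is Num.real ->
  circle_form a b c (u - d) = circle_form a b c u
    - ((b - c * u^*) * d + ((b - c * u^*) * d)^*) - c * (d * d^*).
Proof.
move=> /CrealP cR; rewrite /circle_form.
rewrite !(rmorphB, rmorphM) /= !conjCK cR; ring.
Qed.

Lemma horner_deriv_prod_XsubC (r : seq C) u :
  (forall z, z \in r -> u != z) ->
  (\prod_(z <- r) ('X - z%:P))^`().[u]
    = (\prod_(z <- r) ('X - z%:P)).[u] * \sum_(z <- r) (u - z)^-1.
Proof.
elim: r => [|z r IH] ur; first by rewrite !big_nil derivC !hornerE.
rewrite !big_cons derivM derivXsubC !hornerE IH; last first.
  by move=> y yr; apply: ur; rewrite inE yr orbT.
have : u - z != 0 by rewrite subr_eq0 ur // mem_head.
move: (_.[u]) (\sum_(_ <- _) _) => P S nz; field; exact: nz.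
Qed.

(* Divided by [|d|^2], the condition that [u - d] be outside of the region is
   convex in [d^-1]; so it is bounded below by its tangent at [m]. *)
Lemma circle_form_tangent (A B c d m : C) :
  0 <= A -> d != 0 ->
  A - (B * d + (B * d)^*) - c * (d * d^*) <= 0 ->
  A * (m^* * d^-1 + m * (d^-1)^* - m * m^*) - (B * (d^-1)^* + B^* * d^-1) - c
    <= 0.
Proof.
move=> A0 d0; set e := d^-1.
have d0' : d^* != 0 by rewrite conjC_eq0.
have -> : A - (B * d + (B * d)^*) - c * (d * d^*)
   = (A * (e * e^*) - (B * e^* + B^* * e) - c) * `|d| ^+ 2.
  by rewrite normCK /e !(rmorphM, fmorphV) /=; field; rewrite d0.
rewrite pmulr_lle0 ?exprn_gt0 ?normr_gt0 // => H.
apply: le_trans H; rewrite -subr_ge0.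
have -> : A * (e * e^*) - (B * e^* + B^* * e) - c -
   (A * (m^* * e + m * e^* - m * m^*) - (B * e^* + B^* * e) - c)
   = A * `|e - m| ^+ 2 by rewrite normCK rmorphB /=; ring.
by rewrite mulr_ge0 ?exprn_ge0.
Qed.

(** The tangent is real-affine in [f z], so its sum over the roots involves only their number and
    the sum of the [f z]. *)
Lemma sum_tangent (T : Type) (r : seq T) (f : T -> C) (A B c m : C) :
  \sum_(z <- r) (A * (m^* * f z + m * (f z)^* - m * m^*)
                    - (B * (f z)^* + B^* * f z) - c)
  = A * (m^* * (\sum_(z <- r) f z) + m * (\sum_(z <- r) f z)^*)
    - (B * (\sum_(z <- r) f z)^* + B^* * \sum_(z <- r) f z)
    - (size r)%:R * (A * (m * m^*) + c).
Proof.
elim: r => [|z r IH].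
  by rewrite !big_nil rmorph0 !(mulr0, mul0r, addr0, subr0).
rewrite !big_cons IH rmorphD /= -natr1.
by move: (f z) (\sum_(_ <- r) _) => e S; ring.
Qed.

(** Were the expression zero, [m = (u - v)^-1] would be the mean of the numbers [(u - z)^-1] over
    [k] roots [z], missing roots being placed at infinity and contributing 0. The tangent at [m] is
    nonpositive at each of these numbers, because no root lies in [Psi]; but its mean is its value
    at [m], which is positive because [v] lies in [Psi]. *)
Lemma laguerre Psi (k : nat) p u v :
  convex_circular Psi -> (0 < k)%N -> (size p <= k.+1)%N ->
  (forall x, Psi x -> p.[x] != 0) -> Psi u -> Psi v ->
  k%:R * p.[u] + (v - u) * p^`().[u] != 0.
Proof.
move=> [a [b [c [ra c0 PsiP]]]] k0 szp pn0 Pu Pv.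
have pu0 := pn0 _ Pu.
have [r pE] := closed_field_poly_normal p.
have l0 : lead_coef p != 0.
  by rewrite lead_coef_eq0; apply: contraNneq pu0 => ->; rewrite horner0.
have szr : (size r <= k)%N.
  by move: szp; rewrite pE size_scale // size_prod_XsubC ltnS.
have rootr z : z \in r -> ~ Psi z.
  move=> zr /pn0; rewrite pE hornerZ mulf_eq0 (negPf l0) /=.
  by rewrite -rootE root_prod_XsubC zr.
have ur z : z \in r -> u != z.
  by move=> zr; apply: contra_notN (rootr _ zr) => /eqP <-.
have dp : p^`().[u] = p.[u] * \sum_(z <- r) (u - z)^-1.
  by rewrite pE derivZ !hornerZ horner_deriv_prod_XsubC // mulrA.
have -> : k%:R * p.[u] + (v - u) * p^`().[u]
    = p.[u] * (k%:R - (u - v) * \sum_(z <- r) (u - z)^-1) by rewrite dp; ring.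
rewrite mulf_neq0 // subr_eq0; set s := \sum_(z <- r) _; apply/eqP => ks.
have kn0 : k%:R != 0 :> C by rewrite pnatr_eq0 -lt0n.
have uv : u - v != 0.
  by apply: contra_neq kn0 => E; rewrite ks E mul0r.
pose m := (u - v)^-1.
have sE : s = k%:R * m by rewrite ks [_ * s]mulrC mulfK.
have cr := ger0_real c0.
pose A := circle_form a b c u; pose B := b - c * u^*.
have A0 : 0 < A by apply/PsiP.
(* This is [k] times the value of the tangent at [m]. *)
have : 0 < k%:R * (A - (B * (u - v) + (B * (u - v))^*)
     - c * ((u - v) * (u - v)^*)) * `|m| ^+ 2.
  rewrite -circle_formB // subKr pmulr_lgt0 ?exprn_gt0 ?normr_gt0 ?invr_eq0 //.
  by rewrite pmulr_rgt0 ?ltr0n //; apply/PsiP.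
pose L e := A * (m^* * e + m * e^* - m * m^*) - (B * e^* + B^* * e) - c.
have : \sum_(z <- r) L (u - z)^-1 <= 0.
  rewrite big_seq; apply: sumr_le0 => z zr; apply: circle_form_tangent.
  - exact: ltW.
  - by rewrite subr_eq0 ur.
  rewrite -circle_formB // subKr real_leNgt ?circle_form_real //.
  by apply/negP => /PsiP /(rootr _ zr).
have -> : \sum_(z <- r) L (u - z)^-1 = A * (m^* * s + m * s^*)
    - (B * s^* + B^* * s) - (size r)%:R * (A * (m * m^*) + c).
  exact: sum_tangent.
move=> /le_lt_trans H /H; rewrite -subr_gt0.
(* What remains is the share of the [k - size r] roots at infinity: the value of the tangent at 0,
   once for each. *)
have -> : k%:R * (A - (B * (u - v) + (B * (u - v))^*)
    - c * ((u - v) * (u - v)^*)) * `|m| ^+ 2 -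
   (A * (m^* * s + m * s^*) - (B * s^* + B^* * s)
      - (size r)%:R * (A * (m * m^*) + c))
   = - ((k - size r)%:R * (A * `|m| ^+ 2 + c)).
  rewrite normCK sE /m natrB // !(rmorphM, fmorphV, rmorph_nat) /=.
  by field; rewrite uv andbT -rmorphB fmorph_eq0.
rewrite oppr_gt0 => /lt_geF; rewrite mulr_ge0 ?ler0n //.
by rewrite addr_ge0 // mulr_ge0 ?exprn_ge0 // ltW.
Qed.
End Laguerre.

(** * Contraction of pairs of variables *)

Section Contraction.
Variables (C : numClosedFieldType) (A : comAlgType C) (c : {scalar A}).
Variable Psi : C -> Prop.
Hypothesis circPsi : convex_circular Psi.
Implicit Types (x S T : A) (G : {poly A}).

Lemma horner_map_scalar G (a : C) : (map_poly c G).[a] = c G.[a%:A].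
Proof.
rewrite map_polyE (horner_coef_wide _ (size_Poly _)) size_map horner_coef.
rewrite linear_sum; apply: eq_bigr => i _.
rewrite coef_Poly (nth_map 0) ?ltn_ord //.
by rewrite exprZn expr1n -scalerAr mulr1 linearZ /= mulrC.
Qed.

Lemma laguerre_scalar k G u v :
  (0 < k)%N -> (size G <= k.+1)%N ->
  (forall a, Psi a -> c G.[a%:A] != 0) -> Psi u -> Psi v ->
  c (k%:R *: G.[u%:A] + (v - u) *: G^`().[u%:A]) != 0.
Proof.
move=> k0 szG Gn0 Pu Pv.
have -> : c (k%:R *: G.[u%:A] + (v - u) *: G^`().[u%:A]) =
    k%:R * (map_poly c G).[u] + (v - u) * (map_poly c G)^`().[u].
  have -> : (map_poly c G)^`() = map_poly c G^`().
    by apply/polyP => i; rewrite coef_map !coef_deriv coef_map raddfMn.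
  by rewrite !horner_map_scalar linearD !linearZ.
apply: laguerre circPsi k0 _ _ Pu Pv => [|a Pa].
  by rewrite (leq_trans (size_poly _ _)).
by rewrite horner_map_scalar Gn0.
Qed.

Lemma size_affine S : (size (1 + S *: 'X : {poly A})%R <= 2)%N.
Proof.
rewrite (leq_trans (size_polyD _ _)) // geq_max size_poly1 /=.
by rewrite (leq_trans (size_scale_leq _ _)) ?size_polyX.
Qed.

(** For [G = x (1 + a S)^(k+1)] as a polynomial in [a], Laguerre's expression in degree [k + 1] is
    [k + 1] times [x (1 + u S)^k (1 + v S)]. *)
Lemma polarize_one x S k :
  (forall u, Psi u -> c (x * (1 + u *: S) ^+ k.+1) != 0) ->
  forall u v, Psi u -> Psi v ->
    c (x * ((1 + u *: S) ^+ k * (1 + v *: S))) != 0.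
Proof.
move=> xn0 u v Pu Pv.
pose G : {poly A} := x%:P * (1 + S *: 'X) ^+ k.+1.
have GE (a : C) : G.[a%:A] = x * (1 + a *: S) ^+ k.+1.
  by rewrite !hornerE (mulr_algr a S).
have szG : (size G <= k.+2)%N.
  rewrite (leq_trans (size_polyMleq _ _)) //.
  rewrite -subn1 leq_subLR; apply: leq_add (size_polyC_leq1 x) _.
  apply: leq_trans (size_poly_exp_leq _ _) _; rewrite ltnS.
  by rewrite -[leqRHS]mul1n leq_mul // -subn1 leq_subLR size_affine.
have := @laguerre_scalar k.+1 G u v (ltn0Sn _) szG _ Pu Pv.
rewrite GE; have -> : G^`().[u%:A] = k.+1%:R *: (x * (S * (1 + u *: S) ^+ k)).
  rewrite derivM derivC mul0r add0r deriv_exp derivD derivZ derivX derivC.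
  rewrite !(hornerE, hornerMn, horner_exp) (mulr_algr u S) /= scaler_nat; ring.
have -> : k.+1%:R *: (x * (1 + u *: S) ^+ k.+1) +
    (v - u) *: (k.+1%:R *: (x * (S * (1 + u *: S) ^+ k)))
   = k.+1%:R *: (x * ((1 + u *: S) ^+ k * (1 + v *: S))).
  rewrite scalerA [(v - u) * _]mulrC -scalerA -scalerDr; congr (_ *: _).
  rewrite exprS -[v *: S](subrK (u *: S)) -scalerBl scalerAr scalerAl; ring.
rewrite linearZ /= mulf_eq0 negb_or => H.
suff /H/andP[] : forall a : C, Psi a -> c G.[a%:A] != 0 by [].
by move=> a Pa; rewrite GE xn0.
Qed.

(** Twice the polar form of the quadratic polynomial [(1 + a S) (1 + a T)] in [a], taken at [t] and
    [s]. *)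
Definition contractor (t s : C) S T : A :=
  2%:R + (t + s) *: (S + T) + (2 * t * s) *: (S * T).

Lemma contract_affine x S T :
  (forall u v, Psi u -> Psi v -> c (x * ((1 + u *: S) * (1 + v *: T))) != 0) ->
  forall t s, Psi t -> Psi s -> c (x * contractor t s S T) != 0.
Proof.
move=> xn0 t s Pt Ps.
pose G : {poly A} := x *: ((1 + S *: 'X) * (1 + T *: 'X)).
have GE (a : C) : G.[a%:A] = x * ((1 + a *: S) * (1 + a *: T)).
  by rewrite !hornerE /= !(mulr_algr (R := C) (A := A)).
have szG : (size G <= 3)%N.
  rewrite (leq_trans (size_scale_leq _ _)) //.
  rewrite (leq_trans (size_polyMleq _ _)) //.
  by rewrite -subn1 leq_subLR (leq_add (size_affine S) (size_affine T)).
have GE' : G^`().[t%:A] = x * (S * (1 + t *: T) + (1 + t *: S) * T).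
  rewrite derivZ derivM !derivD !derivZ derivX derivC.
  by rewrite !hornerE /= !(mulr_algr (R := C) (A := A)) mulr1.
have := @laguerre_scalar 2 G t s isT szG _ Pt Ps.
rewrite GE GE' => H.
have -> : x * contractor t s S T = 2%:R *: (x * ((1 + t *: S) * (1 + t *: T)))
    + (s - t) *: (x * (S * (1 + t *: T) + (1 + t *: S) * T)); last first.
  by apply: H => a Pa; rewrite (GE a) xn0.
have sc (a : C) (y : A) : a *: y = GRing.in_alg A a * y.
  by rewrite (mulr_algl a y).
by rewrite /contractor !sc; ring.
Qed.

(** Induction on [k] with [x] general: one factor in [S] and one in [T] are detached by
    polarization, contracted, and absorbed into [x]. *)
Lemma contract_power x S T k :
  (forall u v, Psi u -> Psi v ->
     c (x * ((1 + u *: S) ^+ k * (1 + v *: T) ^+ k)) != 0) ->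
  forall t s, Psi t -> Psi s -> c (x * contractor t s S T ^+ k) != 0.
Proof.
move=> + t s Pt Ps; elim: k x => [|k IH] x xn0.
  by move: (xn0 t t Pt Pt); rewrite !expr0 mulr1.
rewrite exprS mulrA; apply: IH => u v Pu Pv; rewrite mulrAC.
apply: contract_affine (Pt) (Ps) => u' v' Pu' Pv'.
have -> : x * ((1 + u *: S) ^+ k * (1 + v *: T) ^+ k) *
   ((1 + u' *: S) * (1 + v' *: T)) =
   x * (1 + v *: T) ^+ k * (1 + v' *: T) * ((1 + u *: S) ^+ k * (1 + u' *: S)).
  by ring.
apply: polarize_one (Pu) (Pu') => w Pw.
have -> : x * (1 + v *: T) ^+ k * (1 + v' *: T) * (1 + w *: S) ^+ k.+1 =
   x * (1 + w *: S) ^+ k.+1 * ((1 + v *: T) ^+ k * (1 + v' *: T)) by ring.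
apply: polarize_one (Pv) (Pv') => w' Pw'.
by rewrite -mulrA; apply: xn0.
Qed.

Lemma contract_prod (I : eqType) (r : seq I) x (S T : I -> A) (k : I -> nat) :
  uniq r ->
  (forall u v : I -> C, (forall i, Psi (u i)) -> (forall i, Psi (v i)) ->
     c (x * \prod_(i <- r) ((1 + u i *: S i) ^+ k i * (1 + v i *: T i) ^+ k i))
       != 0) ->
  forall t s, Psi t -> Psi s ->
    c (x * \prod_(i <- r) contractor t s (S i) (T i) ^+ k i) != 0.
Proof.
move=> + + t s Pt Ps; elim: r x => [|i r IH] x.
  move=> _ /(_ (fun _ => t) (fun _ => t) (fun _ => Pt) (fun _ => Pt)).
  by rewrite !big_nil.
move=> /= /andP[ir ur] xn0; rewrite big_cons mulrA; apply: IH => // u v Pu Pv.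
rewrite mulrAC; apply: contract_power Pt Ps => u' v' Pu' Pv'.
(* As [i] does not occur in [r], changing the points at [i] leaves the other factors alone. *)
pose u1 j := if j == i then u' else u j.
pose v1 j := if j == i then v' else v j.
have : c (x * \prod_(j <- i :: r)
    ((1 + u1 j *: S j) ^+ k j * (1 + v1 j *: T j) ^+ k j)) != 0.
  by apply: xn0 => j; rewrite /u1 /v1; case: ifP.
rewrite big_cons {1}/u1 {1}/v1 eqxx [_ * _ * \prod_(_ <- _) _]mulrC mulrA.
congr (c (x * _ * _) != 0); apply: eq_big_seq => j jr.
by rewrite /u1 /v1 (negPf (memPn ir j jr)).
Qed.

End Contraction.

(** * Hurwitz' theorem *)

Section Hurwitz.
Variable C : numClosedFieldType.
Implicit Types (p q : {poly C}).

(** Every root [z] satisfies [delta <= |z|], whence [|t - z| <= |z| (1 + |t| / delta)]. The factor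
    depends on [p] only through the degree bound, so the estimate survives a limit. *)
Lemma poly_growth (d : nat) p (delta t : C) :
  0 < delta -> (size p <= d.+1)%N ->
  (forall z, `|z| < delta -> p.[z] != 0) ->
  `|p.[t]| <= `|p.[0]| * (1 + `|t| / delta) ^+ d.
Proof.
move=> d0 szp pn0.
have p00 : p.[0] != 0 by rewrite pn0 ?normr0.
have [r pE] := closed_field_poly_normal p.
have l0 : lead_coef p != 0.
  by rewrite lead_coef_eq0; apply: contraNneq p00 => ->; rewrite horner0.
have szr : (size r <= d)%N.
  by move: szp; rewrite pE size_scale // size_prod_XsubC ltnS.
have rootr z : z \in r -> delta <= `|z|.
  move=> zr; rewrite real_leNgt ?normr_real ?(gtr0_real d0) //; apply/negP => zd.
  have := pn0 z zd.
  by rewrite pE hornerZ mulf_eq0 (negPf l0) /= -rootE root_prod_XsubC zr.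
have K1 : 1 <= 1 + `|t| / delta by rewrite lerDl divr_ge0 // ltW.
suff H : `|p.[t]| <= `|p.[0]| * (1 + `|t| / delta) ^+ size r.
  by apply: le_trans H _; rewrite ler_wpM2l // ler_weXn2l.
rewrite pE !hornerZ !normrM -mulrA ler_wpM2l // !horner_prod !normr_prod.
elim: r rootr {pE szr} => [|z r IH] rootr; first by rewrite !big_nil mulr1.
rewrite !big_cons exprS mulrACA ler_pM ?prodr_ge0 //; last first.
  by apply: IH => y yr; apply: rootr; rewrite inE yr orbT.
rewrite !(hornerE, sub0r) normrN.
rewrite (le_trans (ler_normB _ _)) // mulrDr mulr1 addrC lerD2l.
by rewrite mulrCA ler_peMr // ler_pdivlMr // mul1r rootr // mem_head.
Qed.

Lemma horner_le_sum_norm p (e : C) :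
  0 <= e <= 1 -> `|p.[e]| <= \sum_(i < size p) `|p`_i|.
Proof.
case/andP=> e0 e1; rewrite horner_coef (le_trans (ler_norm_sum _ _ _)) //.
apply: ler_sum => i _; rewrite normrM normrX (ger0_norm e0).
by rewrite ler_piMr // exprn_ile1.
Qed.

(** Continuity at 0 made explicit: dividing [p - p(0)] and [q] by the variable turns the bound into
    [|p(0)| <= e M] for all [e] between 0 and 1. *)
Lemma horner0_eq0_of_le p q (K : C) :
  0 <= K -> (forall e : C, 0 < e < 1 -> `|p.[e]| <= K * `|q.[e]|) ->
  q.[0] = 0 -> p.[0] = 0.
Proof.
move=> K0 H q0; apply/eqP; apply: contraT => p0.
have /factor_theorem [q' qE] : root q 0 by apply/eqP.
have /factor_theorem [p' pE'] : root (p - p.[0]%:P) 0.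
  by rewrite rootE !hornerE subrr.
rewrite subr0 in qE pE'.
pose M := \sum_(i < size p') `|p'`_i| + K * \sum_(i < size q') `|q'`_i|.
have M0 : 0 <= M by rewrite addr_ge0 ?mulr_ge0 // sumr_ge0.
pose a := `|p.[0]|.
have a0 : 0 < a by rewrite normr_gt0.
have D0 : 0 < a + M + 1 by rewrite ltr_wpDl // addr_ge0 // ltW.
(* Small enough for both [e < 1] and [e * M < a]. *)
pose e := a / (a + M + 1).
have e0 : 0 < e by rewrite divr_gt0.
have e1 : e < 1 by rewrite ltr_pdivrMr // mul1r -addrA ltrDl ltr_wpDl.
have e01 : 0 <= e <= 1 by rewrite !ltW.
have : a <= e * M.
  have -> : a = `|p.[e] - p'.[e] * e|.
    have := congr1 (fun r => r.[e]) pE'; rewrite !hornerE => <-.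
    by rewrite opprB addrC subrK.
  rewrite (le_trans (ler_normB _ _)) // mulrDr addrC lerD //.
    by rewrite normrM (gtr0_norm e0) mulrC ler_wpM2l ?(ltW e0) ?horner_le_sum_norm.
  apply: le_trans (H e _) _; first by rewrite e0.
  rewrite qE hornerM hornerX normrM (gtr0_norm e0) mulrA mulrC.
  by rewrite ler_wpM2l ?(ltW e0) // ler_wpM2l ?horner_le_sum_norm.
rewrite /e mulrAC ler_pdivlMr // ler_pM2l // => /le_gtF.
by rewrite addrAC ltrDr addr_gt0.
Qed.

Lemma convex_circular_open (Psi : C -> Prop) (u d : C) :
  convex_circular Psi -> Psi u ->
  exists2 delta : C, 0 < delta & forall t, `|t| < delta -> Psi (u + t * d).
Proof.
move=> [a [b [c [ra c0 PsiP]]]] /PsiP Pu.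
pose A := circle_form a b c u; pose B := b - c * u^*.
pose K := 2 * `|B * d| + c * `|d| ^+ 2.
have K0 : 0 <= K by rewrite addr_ge0 ?mulr_ge0 ?exprn_ge0.
have AK : 0 < A + K by rewrite ltr_wpDr.
(* This radius is at most 1, so that [|t|^2 <= |t|] and the form changes by at most [|t| * K], which
   is less than [A]. *)
exists (A / (A + K)); first by rewrite divr_gt0.
move=> t tlt; apply/PsiP.
have t1 : `|t| <= 1.
  by rewrite ltW // (lt_le_trans tlt) // ler_pdivrMr // mul1r lerDl.
rewrite -[t * d]opprK circle_formB ?ger0_real // -/A -/B.
have -> : A - (B * - (t * d) + (B * - (t * d))^*) - c * (- (t * d) * (- (t * d))^*)
  = A - (- (B * d * t + (B * d * t)^*) + c * (t * d * (t * d)^*)).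
  by rewrite !(rmorphM, rmorphN) /=; ring.
rewrite subr_gt0.
have tA : `|t| * K < A.
  have [->|t0] := eqVneq t 0; first by rewrite normr0 mul0r.
  move: tlt; rewrite ltr_pdivlMr // mulrDr; apply: le_lt_trans.
  by rewrite lerDr mulr_ge0 // ltW.
apply: le_lt_trans tA.
rewrite /K mulrDr lerD //.
  apply: le_trans (real_ler_norm _) _.
    by rewrite realN; apply/CrealP; rewrite rmorphD /= conjCK addrC.
  rewrite normrN (le_trans (ler_normD _ _)) // norm_conjC !normrM mulr_natl mulr2n.
  by rewrite mulrDr mulrC.
rewrite -normCK normrM exprMn mulrCA ler_wpM2r ?mulr_ge0 ?exprn_ge0 //.
by rewrite expr2 ler_piMr.
Qed.

Lemma convex_circular_open_fin (I : finType) (Psi : C -> Prop) (u d : I -> C) :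
  convex_circular Psi -> (forall i, Psi (u i)) ->
  exists2 delta : C, 0 < delta &
    forall t, `|t| < delta -> forall i, Psi (u i + t * d i).
Proof.
move=> circPsi Pu.
have /fin_all_exists[f fP] : forall i, exists e : C,
    0 < e /\ forall t, `|t| < e -> Psi (u i + t * d i).
  by move=> i; have [x ? ?] := convex_circular_open (d i) circPsi (Pu i); exists x.
have f0 i : 0 < f i by case: (fP i).
have S0 (P : pred I) : 0 <= \sum_(i | P i) (f i)^-1.
  by apply: sumr_ge0 => i _; rewrite invr_ge0 ltW.
(* A positive lower bound for all [f i] without taking minima; the summand 1 covers an empty [I]. *)
exists (1 + \sum_i (f i)^-1)^-1; first by rewrite invr_gt0 ltr_wpDr.
move=> t tlt i; apply: (fP i).2; apply: lt_le_trans tlt _.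
rewrite -[leRHS]invrK lef_pV2 ?posrE ?invr_gt0 ?ltr_wpDr //.
by rewrite (bigD1 i) //= addrCA lerDl addr_ge0.
Qed.

(* Distinct monomials are distinct characters of the multiplicative monoid
   of vectors, so that Artin's argument shows that they are independent. *)
Lemma meval_eq0 (n : nat) (p : {mpoly C[n]}) : (forall v, p.@[v] = 0) -> p = 0.
Proof.
pose chi (m : 'X_{1..n}) (v : 'I_n -> C) := \prod_i v i ^+ m i.
have indep (r : seq 'X_{1..n}) (a : 'X_{1..n} -> C) : uniq r ->
    (forall v, \sum_(m <- r) a m * chi m v = 0) -> forall m, m \in r -> a m = 0.
  elim: r a => [//|m r IH] a /= /andP[mr ur] a0.
  have ar k : k \in r -> a k = 0.
    move=> kr.
    have /eqP/mnmP km : k != m by apply: contraNneq mr => <-.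
    have [i kmi] : exists i, k i != m i.
      apply/existsP; rewrite -negb_forall; apply/negP => /forallP E.
      by apply: km => i; apply/eqP.
    (* A point at which the characters of [k] and [m] take the different values [2 ^+ k i] and
       [2 ^+ m i]. *)
    pose y j : C := if j == i then 2 else 1.
    have chiy (l : 'X_{1..n}) : chi l y = 2 ^+ l i.
      rewrite /chi (bigD1 i) //= /y eqxx big1 ?mulr1 // => j /negPf ->.
      by rewrite expr1n.
    have /(IH (fun l => a l * (chi l y - chi m y)) ur) : forall v,
        \sum_(l <- r) a l * (chi l y - chi m y) * chi l v = 0.
      move=> v.
      have := a0 (fun j => y j * v j); have := a0 v.
      rewrite !big_cons => E1 E2.
      have {}E2 : a m * chi m y * chi m v
          + \sum_(l <- r) a l * chi l y * chi l v = 0.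
        rewrite -[RHS]E2; congr (_ + _); last apply: eq_bigr => l _;
        by rewrite /chi -mulrA -big_split /=; congr (_ * _); apply: eq_bigr => j _;
           rewrite exprMn.
      (* Subtracting [chi m y] times the relation at [v] from the relation at [y * v] eliminates the
         term of [m]. *)
      transitivity ((a m * chi m y * chi m v + \sum_(l <- r) a l * chi l y * chi l v)
         - chi m y * (a m * chi m v + \sum_(l <- r) a l * chi l v)); last first.
        by rewrite E1 E2 mulr0 subr0.
      rewrite mulrDr opprD addrACA [chi m y * _]mulrC mulrAC subrr add0r.
      rewrite mulr_sumr -sumrB; apply: eq_bigr => l _; ring.
    move=> /(_ k kr) /eqP; rewrite mulf_eq0 !chiy subr_eq0.
    by rewrite -!natrX eqr_nat eqn_exp2l // (negPf kmi) orbF => /eqP.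
  move=> k; rewrite inE => /predU1P [->|/ar //].
  have := a0 (fun=> 1); rewrite big_cons big_seq big1 => [|l lr]; last first.
    by rewrite ar ?mul0r.
  by rewrite addr0 /chi big1 ?mulr1 // => j _; rewrite expr1n.
move=> p0; apply/mpolyP => m; rewrite mcoeff0.
have [mp|] := boolP (m \in msupp p); last by rewrite mcoeff_msupp negbK => /eqP.
apply: (indep (msupp p) (fun k => p@_k) (msupp_uniq p) _ m mp) => v.
by rewrite -[RHS](p0 v) mevalE.
Qed.

(** If [H 0] vanishes at a point [x] of the region, then on the complex line from [x] to any [y] the
    growth estimate bounds [H e] at [y] by a constant, independent of [e], times [H e] at [x].
    Letting [e] tend to 0 gives [H 0 = 0] at [y]. *)
Lemma hurwitz (Psi : C -> Prop) (n J : nat) (h : nat -> {mpoly C[n]}) :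
  convex_circular Psi ->
  let H (e : C) := \sum_(j < J) e ^+ j *: h j in
  (forall e : C, 0 < e < 1 -> forall x, (forall i, Psi (x i)) -> (H e).@[x] != 0) ->
  (forall x, (forall i, Psi (x i)) -> (H 0).@[x] != 0) \/ H 0 = 0.
Proof.
move=> circPsi H Hn0.
have [->|H0] := eqVneq (H 0) 0; [by right|left => x Px].
apply: contra_neq H0 => Hx; apply: meval_eq0 => y.
have [delta d0 Pd] := convex_circular_open_fin (fun i => y i - x i) circPsi Px.
(* Restriction to the line [x + t (y - x)], as a polynomial in [t]. *)
pose phi := mmap (@polyC C) (fun i => (x i)%:P + (y i - x i) *: 'X).
have phiE (r : {mpoly C[n]}) (t : C) :
    (phi r).[t] = r.@[fun i => x i + t * (y i - x i)].
  rewrite /phi mevalE /mmap horner_sum; apply: eq_bigr => m _.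
  rewrite !hornerE /mmap1 horner_prod; congr (_ * _); apply: eq_bigr => i _.
  by rewrite !hornerE mulrC.
(* A degree bound on the line that is uniform in [e]. *)
pose D := \max_(j < J) size (phi (h j)).
pose P (v : 'I_n -> C) := \poly_(j < J) (h j).@[v].
have PE v (e : C) : (P v).[e] = (H e).@[v].
  rewrite horner_poly /H raddf_sum; apply: eq_bigr => j _.
  by rewrite /= mevalZ mulrC.
rewrite -PE; apply: (@horner0_eq0_of_le _ (P x) ((1 + `|1| / delta) ^+ D)).
- by rewrite exprn_ge0 // addr_ge0 // divr_ge0 // ltW.
- move=> e e01; rewrite mulrC !PE.
  have ev0 (r : {mpoly C[n]}) : r.@[x] = (phi r).[0].
    by rewrite phiE; apply: meval_eq => i; rewrite mul0r addr0.
  have ev1 (r : {mpoly C[n]}) : r.@[y] = (phi r).[1].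
    by rewrite phiE; apply: meval_eq => i; rewrite mul1r addrC subrK.
  rewrite ev0 ev1; apply: poly_growth => //.
    rewrite /H /phi raddf_sum /= (leq_trans (size_sum _ _ _)) //.
    apply/bigmax_leqP => j _; rewrite leqW //.
    apply: leq_trans (leq_bigmax j).
    by rewrite /phi mmapZ mul_polyC size_scale_leq.
  by move=> z zd; rewrite phiE; apply: Hn0 e01 _ (Pd z zd).
- by rewrite PE.
Qed.

End Hurwitz.

(* While [l * contractor t s] depends polynomially on [e], the points [t] and [s]
   may leave the region as [e] tends to [0]. *)
Lemma contraction_limit (C : numClosedFieldType) (Psi : C -> Prop)
    (A : comAlgType C) (m : nat) (c : {linear A -> {mpoly C[m]}})
    (I : finType) (S T : I -> A) (k : I -> nat) (al be ga : {poly C}) :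
  convex_circular Psi ->
  (forall e : C, 0 < e < 1 -> exists t s l : C,
    [/\ Psi t, Psi s, l != 0 &
      [/\ al.[e] = l * 2, be.[e] = l * (t + s) & ga.[e] = l * (2 * t * s)]]) ->
  (forall (x : 'I_m -> C) (u v : I -> C), (forall i, Psi (x i)) ->
     (forall i, Psi (u i)) -> (forall i, Psi (v i)) ->
     (c (\prod_i ((1 + u i *: S i) ^+ k i * (1 + v i *: T i) ^+ k i))).@[x] != 0) ->
  let h := c (\prod_i (al.[0]%:A + be.[0] *: (S i + T i)
             + ga.[0] *: (S i * T i)) ^+ k i) in
  (forall x, (forall i, Psi (x i)) -> h.@[x] != 0) \/ h = 0.
Proof.
move=> circPsi abg cn0 h.
pose lift (p : {poly C}) : {poly A} := map_poly (GRing.in_alg A) p.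
have liftE (p : {poly C}) (e : C) : (lift p).[e%:A] = p.[e]%:A.
  by rewrite -[e%:A]/(GRing.in_alg A e) horner_map.
(* The scaled product as a polynomial in [e]; the images under [c] of its coefficients are the [h j]
   of Hurwitz' theorem. *)
pose G : {poly A} := \prod_i (lift al + lift be * (S i + T i)%:P
  + lift ga * (S i * T i)%:P) ^+ k i.
have GE (e : C) : G.[e%:A] = \prod_i (al.[e]%:A + be.[e] *: (S i + T i)
     + ga.[e] *: (S i * T i)) ^+ k i.
  rewrite horner_prod; apply: eq_bigr => i _.
  rewrite horner_exp !hornerD !hornerM !hornerC !liftE.
  by rewrite !(mulr_algl (R := C) (A := A)).
have pE (e : C) : \sum_(j < size G) e ^+ j *: c G`_j = c G.[e%:A].
  rewrite horner_coef raddf_sum; apply: eq_bigr => j _ /=.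
  by rewrite exprZn expr1n (mulr_algr (R := C) (A := A)) linearZ.
have := @hurwitz _ Psi _ (size G) (fun j => c G`_j) circPsi.
rewrite /= pE (GE 0) -/h; apply=> e e01 x Px; rewrite pE (GE e).
have [t [s [l [Pt Ps l0 [-> -> ->]]]]] := abg e e01.
(* Fixing [x] yields the scalar functional to which contraction applies. *)
pose cx : {scalar A} := meval x \o c.
have H : cx (1 * \prod_i contractor t s (S i) (T i) ^+ k i) != 0.
  apply: (contract_prod circPsi) (index_enum_uniq _) _ _ _ Pt Ps => u v Pu Pv.
  by rewrite mul1r; apply: cn0.
have -> : \prod_i ((l * 2)%:A + (l * (t + s)) *: (S i + T i)
    + (l * (2 * t * s)) *: (S i * T i)) ^+ k i
  = (\prod_i l ^+ k i) *: \prod_i contractor t s (S i) (T i) ^+ k i.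
  rewrite -scaler_prod; apply: eq_bigr => i _.
  rewrite -exprZn /contractor !scalerDr !scalerA; congr ((_ + _ + _) ^+ _).
  by rewrite -scalerA scaler_nat -scalerDr.
rewrite linearZ /= mevalZ mulf_neq0 //; last by rewrite mul1r in H.
by apply/prodf_neq0 => i _; rewrite expf_neq0.
Qed.

(** * Sums over multi-indices and formal derivatives *)

Section MultiIndexSums.
Variables (n : nat) (k : 'X_{1..n}).

Lemma mnm_le_mdeg (a : 'X_{1..n}) i : (a i <= mdeg a)%N.
Proof. by rewrite mdegE (bigD1 i) //= leq_addr. Qed.

Lemma lepm_mdeg (a : 'X_{1..n}) : (a <= k)%MM -> (mdeg a < (mdeg k).+1)%N.
Proof. by move=> /mnm_lepP ak; rewrite ltnS !mdegE leq_sum. Qed.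

Lemma sum_lepm_only (V : nmodType) (F : 'X_{1..n} -> V) (a : 'X_{1..n}) :
  (a <= k)%MM -> (forall b, b != a -> F b = 0) ->
  \sum_(b : 'X_{1..n < (mdeg k).+1} | (bmnm b <= k)%MM) F b = F a.
Proof.
move=> ak F0; rewrite (bigD1 (BMultinom (lepm_mdeg ak))) //= big1 ?addr0 //.
by move=> b /andP[_ ba]; apply: F0; rewrite bmeqP in ba.
Qed.

(** Distributivity: a choice of [j <= k i] for each [i] is a multi-index below [k]. All choices are
    first put into one ordinal type, so that they become functions. *)
Lemma sum_lepm_prod (A : comPzSemiRingType) (F : 'I_n -> nat -> A) :
  \sum_(a : 'X_{1..n < (mdeg k).+1} | (bmnm a <= k)%MM) \prod_i F i (a i)
  = \prod_i \sum_(j < (k i).+1) F i j.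
Proof.
pose d := mdeg k.
have -> : \prod_i \sum_(j < (k i).+1) F i j
  = \prod_i \sum_(j < d.+1 | (j <= k i)%N) F i j.
  apply: eq_bigr => i _; rewrite (big_ord_widen d.+1 (F i)) //.
  by rewrite ltnS mnm_le_mdeg.
rewrite bigA_distr_big_dep /=.
pose toF (a : 'X_{1..n < d.+1}) : {ffun 'I_n -> 'I_d.+1} :=
  [ffun i => inord (a i)].
(* The default [bm0] is never reached in the family of choices below [k], whose degrees are at most
   [d]. *)
pose ofF (f : {ffun 'I_n -> 'I_d.+1}) : 'X_{1..n < d.+1} :=
  insubd bm0 [multinom (f i : nat) | i < n].
have toFE a i : toF a i = a i :> nat.
  by rewrite ffunE inordK // (leq_ltn_trans (mnm_le_mdeg _ _)) ?bmdeg.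
have toFK a : ofF (toF a) = a.
  apply/val_inj; rewrite /= insubdK.
    by apply/mnmP => i; rewrite mnmE toFE.
  rewrite unfold_in /=; have -> : [multinom (toF a i : nat) | i < n] = bmnm a.
    by apply/mnmP => i; rewrite mnmE toFE.
  exact: bmdeg.
rewrite (reindex_onto toF ofF) /= => [|f /familyP fk].
  apply: eq_big => [a|a _]; last by apply: eq_bigr => i _; rewrite toFE.
  rewrite toFK eqxx andbT; apply/mnm_lepP/familyP => ak i; have := ak i.
    by rewrite unfold_in /= toFE.
  by rewrite unfold_in /= toFE.
apply/ffunP => i; apply/val_inj; rewrite [LHS]toFE insubdK ?mnmE //.
rewrite unfold_in /= lepm_mdeg //; apply/mnm_lepP => j; rewrite mnmE.
by have := fk j; rewrite unfold_in.
Qed.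

Lemma prod_exprD (A : comPzSemiRingType) (x y : 'I_n -> A) :
  \prod_i (x i + y i) ^+ k i
  = \sum_(a : 'X_{1..n < (mdeg k).+1} | (bmnm a <= k)%MM)
      \prod_i x i ^+ (k - a)%MM i * \prod_i y i ^+ a i *+ mbinom k a.
Proof.
transitivity (\prod_i \sum_(j < (k i).+1) x i ^+ (k i - j) * y i ^+ j *+ 'C(k i, j)).
  by apply: eq_bigr => i _; rewrite exprDn.
rewrite -(sum_lepm_prod (fun i j => x i ^+ (k i - j) * y i ^+ j *+ 'C(k i, j))).
apply: eq_bigr => a _; rewrite prodrMn big_split.
by congr (_ * _ *+ _); apply: eq_bigr => i _; rewrite ?mnmBE.
Qed.

End MultiIndexSums.

(** * Exponents of the two blocks of variables, and multi-index factorials *)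

Section Exponents.
Variable n : nat.
Implicit Types a b : 'X_{1..n}.

Lemma split_lshift (i : 'I_n) : split (lshift n i) = inl i.
Proof. exact: (unsplitK (inl i)). Qed.

Lemma split_rshift (i : 'I_n) : split (rshift n i) = inr i.
Proof. exact: (unsplitK (inr i)). Qed.

Lemma zexp_lshift a i : zexp a (lshift n i) = a i.
Proof. by rewrite mnmE split_lshift. Qed.

Lemma zexp_rshift a i : zexp a (rshift n i) = 0%N.
Proof. by rewrite mnmE split_rshift. Qed.

Lemma wexp_lshift a i : wexp a (lshift n i) = 0%N.
Proof. by rewrite mnmE split_lshift. Qed.

Lemma wexp_rshift a i : wexp a (rshift n i) = a i.
Proof. by rewrite mnmE split_rshift. Qed.

Definition zwexpE :=
  (zexp_lshift, zexp_rshift, wexp_lshift, wexp_rshift).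

Lemma zexpDwexp_inj a b a' b' :
  (zexp a + wexp b = zexp a' + wexp b')%MM -> a = a' /\ b = b'.
Proof.
move=> /mnmP E; split; apply/mnmP => i.
  by have := E (lshift n i); rewrite !mnmDE !zwexpE !addn0.
by have := E (rshift n i); rewrite !mnmDE !zwexpE.
Qed.

Lemma zexp_inj : injective (@zexp n).
Proof. by move=> a b E; case: (@zexpDwexp_inj a 0 b 0); rewrite ?E. Qed.

Lemma wexp_inj : injective (@wexp n).
Proof. by move=> a b E; case: (@zexpDwexp_inj 0 a 0 b); rewrite ?E. Qed.

Lemma prod_zexp_fact a : (\prod_i (zexp a i)`! = mfact a)%N.
Proof.
rewrite big_split_ord /= [X in (_ * X)%N]big1 ?muln1 => [|i _].
  by apply: eq_bigr => i _; rewrite zwexpE.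
by rewrite zwexpE.
Qed.

Lemma prod_wexp_fact a : (\prod_i (wexp a i)`! = mfact a)%N.
Proof.
rewrite big_split_ord /= big1 ?mul1n => [|i _].
  by apply: eq_bigr => i _; rewrite zwexpE.
by rewrite zwexpE.
Qed.

Lemma mbinom_fact (k a : 'X_{1..n}) : (a <= k)%MM ->
  (mbinom k a * (mfact a * mfact (k - a)))%N = mfact k.
Proof.
move=> /mnm_lepP ak; rewrite /mbinom /mfact -!big_split /=.
by apply: eq_bigr => i _; rewrite mnmBE bin_fact.
Qed.

Lemma mbinom_sub (k a : 'X_{1..n}) : (a <= k)%MM -> mbinom k (k - a) = mbinom k a.
Proof.
by move=> /mnm_lepP ak; apply: eq_bigr => i _; rewrite mnmBE bin_sub.
Qed.

Lemma mfact_gt0 a : (0 < mfact a)%N.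
Proof. by apply: prodn_gt0 => i; apply: fact_gt0. Qed.

End Exponents.

(** The variables in [K] are set to 0 after differentiation. If [b i < a i] for some [i], a falling
    factorial vanishes; if [b i > a i], a positive power of a variable set to 0 remains. *)
Lemma mderivm_comp_at0 (A : comNzRingType) (N : nat) (K : pred 'I_N)
    (lq : N.-tuple {mpoly A[N]}) (a b e : 'X_{1..N}) :
  (forall i, tnth lq i = if K i then 0 else 'X_i) ->
  (forall i, K i -> e i = 0%N) ->
  (forall i, ~~ K i -> a i = 0%N /\ b i = 0%N) ->
  'X_[e + b]^`M[a] \mPo lq
    = if b == a then (\prod_i (a i)`!)%:R *: 'X_[e] else 0.
Proof.
move=> lqE eK abK; rewrite mderivmX comp_mpolyZ comp_mpolyX.
have [->|/eqP ba] := eqVneq b a.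
  congr (_%:R *: _).
    apply: eq_bigr => i _; rewrite mnmDE; have [Ki|/abK[-> _]] := boolP (K i).
      by rewrite eK // add0n ffactnn.
    by rewrite ffactn0.
  rewrite addmK [RHS]mpolyXE_id; apply: eq_bigr => i _; rewrite lqE.
  by case: ifP => // Ki; rewrite eK ?expr0.
have [i bai] : exists i, b i != a i.
  apply/existsP; rewrite -negb_forall; apply/negP => /forallP E.
  by apply: ba; apply/mnmP => i; apply/eqP.
have Ki : K i by apply: contraNT bai => /abK [-> ->].
case: (ltngtP (b i) (a i)) bai => // lt_ba _.
  by rewrite (bigD1 i) //= mnmDE eK // ffact_small // mul0n scale0r.
rewrite [X in _ *: X](bigD1 i) //= lqE Ki mnmBE mnmDE eK //.
by rewrite expr0n subn_eq0 leqNgt lt_ba mul0r scaler0.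
Qed.

(** * Polynomials in one block of variables and their Taylor coefficients *)

Section BlockVariables.
Variables (R : realType) (n : nat).
Local Notation C := R[i].
Implicit Types (p q : {mpoly C[n]}) (m a b : 'X_{1..n}).

Lemma mpolyX_zexp m : 'X_[zexp m] = \prod_i 'X_(lshift n i) ^+ m i :> {mpoly C[n + n]}.
Proof.
rewrite mpolyXE_id big_split_ord /= [X in _ * X]big1 ?mulr1 => [|i _].
  by apply: eq_bigr => i _; rewrite zwexpE.
by rewrite zwexpE expr0.
Qed.

Lemma mpolyX_wexp m : 'X_[wexp m] = \prod_i 'X_(rshift n i) ^+ m i :> {mpoly C[n + n]}.
Proof.
rewrite mpolyXE_id big_split_ord /= big1 ?mul1r => [|i _].
  by apply: eq_bigr => i _; rewrite zwexpE.
by rewrite zwexpE expr0.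
Qed.

Lemma in_zE p : in_z p = \sum_(m <- msupp p) p@_m *: 'X_[zexp m].
Proof.
rewrite /in_z comp_mpolyE; apply: eq_bigr => m _; rewrite mpolyX_zexp.
by congr (_ *: _); apply: eq_bigr => i _; rewrite tnth_mktuple.
Qed.

Lemma in_wE p : in_w p = \sum_(m <- msupp p) p@_m *: 'X_[wexp m].
Proof.
rewrite /in_w comp_mpolyE; apply: eq_bigr => m _; rewrite mpolyX_wexp.
by congr (_ *: _); apply: eq_bigr => i _; rewrite tnth_mktuple.
Qed.

Lemma meval_in_z p (x : 'I_(n + n) -> C) :
  (in_z p).@[x] = p.@[fun i => x (lshift n i)].
Proof.
rewrite comp_mpoly_meval; apply: meval_eq => i.
by rewrite tnth_mktuple mevalXU.
Qed.

Lemma meval_in_w p (x : 'I_(n + n) -> C) :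
  (in_w p).@[x] = p.@[fun i => x (rshift n i)].
Proof.
rewrite comp_mpoly_meval; apply: meval_eq => i.
by rewrite tnth_mktuple mevalXU.
Qed.

Lemma at_z0_mderivm p a b :
  at_z0 ((in_w p * 'X_[zexp b])^`M[zexp a])
  = if b == a then (mfact a)%:R *: in_w p else 0.
Proof.
rewrite in_wE mulr_suml raddf_sum /at_z0 raddf_sum /=.
transitivity (\sum_(m <- msupp p)
    p@_m *: (if b == a then (mfact a)%:R *: 'X_[wexp m] else 0 : {mpoly C[n + n]})).
  apply: eq_bigr => m _.
  rewrite -scalerAl mderivmZ comp_mpolyZ -mpolyXD; congr (_ *: _).
  rewrite (@mderivm_comp_at0 _ _ (fun i => if split i is inl _ then true else false)).
  - by rewrite (inj_eq (@zexp_inj n)) prod_zexp_fact.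
  - by move=> i; rewrite tnth_mktuple; case: (split i).
  - by move=> i; rewrite mnmE; case: (split i).
  - by move=> i; rewrite !mnmE; case: (split i).
case: eqP => _; last by rewrite big1 // => m _; rewrite scaler0.
by rewrite scaler_sumr; apply: eq_bigr => m _; rewrite !scalerA mulrC.
Qed.

Lemma at_w0_mderivm p a b :
  at_w0 ((in_z p * 'X_[wexp b])^`M[wexp a])
  = if b == a then (mfact a)%:R *: in_z p else 0.
Proof.
rewrite in_zE mulr_suml raddf_sum /at_w0 raddf_sum /=.
transitivity (\sum_(m <- msupp p)
    p@_m *: (if b == a then (mfact a)%:R *: 'X_[zexp m] else 0 : {mpoly C[n + n]})).
  apply: eq_bigr => m _.
  rewrite -scalerAl mderivmZ comp_mpolyZ -mpolyXD; congr (_ *: _).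
  rewrite (@mderivm_comp_at0 _ _ (fun i => if split i is inr _ then true else false)).
  - by rewrite (inj_eq (@wexp_inj n)) prod_wexp_fact.
  - by move=> i; rewrite tnth_mktuple; case: (split i).
  - by move=> i; rewrite mnmE; case: (split i).
  - by move=> i; rewrite !mnmE; case: (split i).
case: eqP => _; last by rewrite big1 // => m _; rewrite scaler0.
by rewrite scaler_sumr; apply: eq_bigr => m _; rewrite !scalerA mulrC.
Qed.

End BlockVariables.

(** * The composition theorem *)

Section Regions.
Variable R : realType.
Local Notation C := R[i].

Lemma half_plane_circular (theta : R) : convex_circular (half_plane theta).
Proof.
(* Twice the real part of [- 'i * y] is twice the imaginary part of [y]. *)
exists 0, (- 'i%C * cis theta), 0; split=> [||x]; rewrite ?rpred0 //.
have -> : circle_form 0 (- 'i%C * cis theta) 0 x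
    = ((complex.Im (cis theta * x) *+ 2)%:C)%C.
  case: x => p q; rewrite /circle_form /cis mul0r add0r subr0.
  simpc; apply/eqP; rewrite eq_complex /= eqxx andbT mulr2n.
  by rewrite [trigo.cos.body _ * _ + _]addrC.
by rewrite ltcR pmulrn_lgt0.
Qed.

Lemma unit_disk_circular : convex_circular (@unit_disk R).
Proof.
exists 1, 0, 1; split=> [||x]; rewrite ?rpred1 ?ler01 //.
rewrite /circle_form mul0r rmorph0 !addr0 mul1r -normCK subr_gt0.
by rewrite expr_lt1.
Qed.

(** The inner normal of the half-plane: rotation by [cis theta] takes it to ['i]. *)
Definition half_plane_dir (theta : R) : C := 'i%C * (cis theta)^*%C.

Lemma half_plane_dirP (theta : R) (e : C) :
  0 < e -> half_plane theta (e * half_plane_dir theta).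
Proof.
move=> e0; rewrite /half_plane.
have -> : cis theta * (e * half_plane_dir theta) = e * 'i%C.
  have cc : cis theta * (cis theta)^*%C = 1.
    rewrite /cis; simpc.
    by rewrite -!expr2 trigo.cos2Dsin2 [trigo.sin.body _ * _]mulrC addNr.
  by rewrite /half_plane_dir mulrCA [cis theta * _]mulrCA cc mulr1.
by rewrite ImiRe; move: e0; rewrite ltcE => /andP[].
Qed.

Lemma half_plane_dir_neq0 (theta : R) : half_plane_dir theta != 0.
Proof.
apply/eqP => w0; have := @half_plane_dirP theta 1 ltr01.
by rewrite w0 /half_plane !mulr0 ltxx.
Qed.

End Regions.

(** * The pairing functional and its two limits *)

Section Composition.
Variables (R : realType) (n : nat) (k : 'X_{1..n}).
Variables P Q : 'X_{1..n} -> {mpoly R[i][n]}.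
Local Notation C := R[i].
Local Notation A := {mpoly C[n + n]}.
Local Notation S i := ('X_(lshift n i) : A).
Local Notation T i := ('X_(rshift n i) : A).

Let f := msum_le k (fun a => (mbinom k a)%:R *: (in_w (P a) * 'X_[zexp a])).
Let g := msum_le k (fun a => (mbinom k a)%:R *: (in_z (Q a) * 'X_[wexp a])).

Lemma at_z0_mderivm_sum a : (a <= k)%MM ->
  at_z0 (f^`M[zexp a]) = (mbinom k a * mfact a)%:R *: in_w (P a).
Proof.
move=> ak; rewrite /f /msum_le raddf_sum /at_z0 raddf_sum /=.
rewrite (@sum_lepm_only _ k _ (fun b =>
  ((mbinom k b)%:R *: (in_w (P b) * 'X_[zexp b]))^`M[zexp a] \mPo _) a) //.
  by rewrite mderivmZ comp_mpolyZ [X in _ *: X]at_z0_mderivm eqxx scalerA -natrM.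
move=> b ba.
by rewrite mderivmZ comp_mpolyZ [X in _ *: X]at_z0_mderivm (negPf ba) scaler0.
Qed.

Lemma at_w0_mderivm_sum a : (a <= k)%MM ->
  at_w0 (g^`M[wexp a]) = (mbinom k a * mfact a)%:R *: in_z (Q a).
Proof.
move=> ak; rewrite /g /msum_le raddf_sum /at_w0 raddf_sum /=.
rewrite (@sum_lepm_only _ k _ (fun b =>
  ((mbinom k b)%:R *: (in_z (Q b) * 'X_[wexp b]))^`M[wexp a] \mPo _) a) //.
  by rewrite mderivmZ comp_mpolyZ [X in _ *: X]at_w0_mderivm eqxx scalerA -natrM.
move=> b ba.
by rewrite mderivmZ comp_mpolyZ [X in _ *: X]at_w0_mderivm (negPf ba) scaler0.
Qed.

(** Term by term, with [C] the binomial coefficient of [k] and [a], this is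
    [C^2 a! (k - a)! = k! C]. *)
Lemma half_plane_sum_mderivm :
  msum_le k (fun a => (mbinom k a)%:R *: (in_w (P a) * in_z (Q (k - a)%MM)))
  = (mfact k)%:R^-1 *: msum_le k (fun a =>
      at_z0 (f^`M[zexp a]) * at_w0 (g^`M[wexp (k - a)%MM])).
Proof.
rewrite /msum_le scaler_sumr; apply: eq_bigr => a ak.
rewrite at_z0_mderivm_sum // at_w0_mderivm_sum ?lem_subr // mbinom_sub //.
rewrite -scalerAl -scalerAr !scalerA; congr (_ *: _).
have k0 : (mfact k)%:R != 0 :> C by rewrite pnatr_eq0 -lt0n mfact_gt0.
apply: (mulfI k0); rewrite -mulrA mulVKf // -!natrM -(mbinom_fact ak).
by congr _%:R; lia.
Qed.

(** The weight turns one of the two factors [a!] into [(k - a)!], which leads to the same identity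
    between binomials and factorials. *)
Lemma disk_sum_mderivm :
  msum_le k (fun a => (mbinom k a)%:R *: (in_w (P a) * in_z (Q a)))
  = (mfact k)%:R^-1 *: msum_le k (fun a =>
      ((mfact (k - a)%MM)%:R / (mfact a)%:R) *:
         (at_z0 (f^`M[zexp a]) * at_w0 (g^`M[wexp a]))).
Proof.
rewrite /msum_le scaler_sumr; apply: eq_bigr => a ak.
rewrite at_z0_mderivm_sum // at_w0_mderivm_sum //.
rewrite -scalerAl -scalerAr !scalerA; congr (_ *: _).
have k0 (b : 'X_{1..n}) : (mfact b)%:R != 0 :> C by rewrite pnatr_eq0 -lt0n mfact_gt0.
apply: (mulfI (k0 k)); rewrite -!mulrA mulVKf //.
rewrite -(mbinom_fact ak) !natrM; field; exact: k0.
Qed.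

(* The functional sending S^a T^b to P_a(w) Q_b(z) for [a, b <= k]; the other
   monomials, which are sent to 0, do not occur in the products it is applied to. *)
Definition pairing (p : {mpoly C[n + n]}) : {mpoly C[n + n]} :=
  msum_le k (fun a => msum_le k (fun b =>
    p@_(zexp a + wexp b) *: (in_w (P a) * in_z (Q b)))).

Lemma pairing_is_linear : linear pairing.
Proof.
move=> s p q; rewrite /pairing /msum_le scaler_sumr -big_split /=.
apply: eq_bigr => a _; rewrite scaler_sumr -big_split /=.
by apply: eq_bigr => b _; rewrite mcoeffD mcoeffZ scalerDl scalerA.
Qed.

HB.instance Definition _ :=
  GRing.isLinear.Build C {mpoly C[n + n]} {mpoly C[n + n]} _ pairing
    pairing_is_linear.

Lemma pairingX a b : (a <= k)%MM -> (b <= k)%MM ->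
  pairing 'X_[zexp a + wexp b] = in_w (P a) * in_z (Q b).
Proof.
move=> ak bk; rewrite /pairing /msum_le.
rewrite (@sum_lepm_only _ k _ (fun a' => \sum_(b' : 'X_{1..n < _} | _)
  'X_[zexp a + wexp b]@_(zexp a' + wexp b') *: (in_w (P a') * in_z (Q b'))) a) //.
  rewrite (@sum_lepm_only _ k _ (fun b' =>
    'X_[zexp a + wexp b]@_(zexp a + wexp b') *: (in_w (P a) * in_z (Q b'))) b) //.
    by rewrite mcoeffX eqxx scale1r.
  move=> b' bb'; rewrite mcoeffX.
  case: eqP => [/zexpDwexp_inj[_ E]|]; last by rewrite scale0r.
  by rewrite E eqxx in bb'.
move=> a' aa'; rewrite big1 // => b' _; rewrite mcoeffX.
case: eqP => [/zexpDwexp_inj[E _]|]; last by rewrite scale0r.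
by rewrite E eqxx in aa'.
Qed.

Definition zw_point (z w : 'I_n -> C) (i : 'I_(n + n)) : C :=
  match split i with inl j => z j | inr j => w j end.

Lemma prod_exprD_zexp (u : 'I_n -> C) :
  \prod_i (1 + u i *: S i) ^+ k i = msum_le k (fun a =>
    ((mbinom k a)%:R * \prod_i u i ^+ a i) *: 'X_[zexp a]).
Proof.
rewrite prod_exprD; apply: eq_bigr => a _.
rewrite big1 => [|i _]; last by rewrite expr1n.
rewrite mul1r mpolyX_zexp (eq_bigr _ (fun i _ => exprZn _ _ _)).
by rewrite scaler_prod scalerMnl mulr_natl.
Qed.

Lemma prod_exprD_wexp (v : 'I_n -> C) :
  \prod_i (1 + v i *: T i) ^+ k i = msum_le k (fun a =>
    ((mbinom k a)%:R * \prod_i v i ^+ a i) *: 'X_[wexp a]).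
Proof.
rewrite prod_exprD; apply: eq_bigr => a _.
rewrite big1 => [|i _]; last by rewrite expr1n.
rewrite mul1r mpolyX_wexp (eq_bigr _ (fun i _ => exprZn _ _ _)).
by rewrite scaler_prod scalerMnl mulr_natl.
Qed.

(** The expanded powers carry the same binomial weights as [f] and [g], so the double sum factors.
    Stability of [f] and [g] thereby becomes the hypothesis needed for contraction. *)
Lemma pairing_affine_prod (x : 'I_(n + n) -> C) (u v : 'I_n -> C) :
  (pairing
    (\prod_i ((1 + u i *: S i) ^+ k i * (1 + v i *: T i) ^+ k i))).@[x]
  = f.@[zw_point u (fun i => x (rshift n i))]
    * g.@[zw_point (fun i => x (lshift n i)) v].
Proof.
(* [c] hides the sums in [pairing] from [raddf_sum]. *)
have [c cE] : exists c : {linear A -> A}, pairing =1 c.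
  by exists pairing.
rewrite cE big_split /= prod_exprD_zexp prod_exprD_wexp /f /g /msum_le.
rewrite mulr_suml !raddf_sum mulr_suml; apply: eq_bigr => a ak.
rewrite mulr_sumr !raddf_sum mulr_sumr; apply: eq_bigr => b bk.
rewrite -scalerAl -scalerAr -mpolyXD /= !linearZ /= -cE pairingX //.
rewrite 3!mevalM.
have Qz := meval_in_z (Q b); have Pw := meval_in_w (P a).
move: (in_z (Q b)) (in_w (P a)) Qz Pw => q p Qz Pw; rewrite !Qz !Pw {q p Qz Pw}.
have -> : 'X_[zexp a].@[zw_point u (fun i => x (rshift n i))]
    = \prod_i u i ^+ a i.
  rewrite mpolyX_zexp rmorph_prod; apply: eq_bigr => i _ /=.
  by rewrite rmorphXn /= mevalXU /zw_point split_lshift.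
have -> : 'X_[wexp b].@[zw_point (fun i => x (lshift n i)) v]
    = \prod_i v i ^+ b i.
  rewrite mpolyX_wexp rmorph_prod; apply: eq_bigr => i _ /=.
  by rewrite rmorphXn /= mevalXU /zw_point split_rshift.
have -> : (P a).@[fun i => zw_point u (fun i => x (rshift n i)) (rshift n i)]
    = (P a).@[fun i => x (rshift n i)].
  by apply: meval_eq => i; rewrite /zw_point split_rshift.
have -> : (Q b).@[fun i => zw_point (fun i => x (lshift n i)) v (lshift n i)]
    = (Q b).@[fun i => x (lshift n i)].
  by apply: meval_eq => i; rewrite /zw_point split_lshift.
ring.
Qed.

Lemma pairing_limit_stable (Psi : C -> Prop) (al be ga : {poly C}) :
  convex_circular Psi ->
  (forall e : C, 0 < e < 1 -> exists t s l : C,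
    [/\ Psi t, Psi s, l != 0 &
      [/\ al.[e] = l * 2, be.[e] = l * (t + s) & ga.[e] = l * (2 * t * s)]]) ->
  stable Psi f -> stable Psi g ->
  let h := pairing (\prod_i (al.[0]%:A + be.[0] *: (S i + T i)
             + ga.[0] *: (S i * T i)) ^+ k i) in
  stable Psi h \/ h = 0.
Proof.
move=> circPsi abg fs gs.
apply: (contraction_limit circPsi abg) => x u v Px Pu Pv.
rewrite pairing_affine_prod mulf_neq0 //.
  by apply: fs => i; rewrite /zw_point; case: (split i) => j.
by apply: gs => i; rewrite /zw_point; case: (split i) => j.
Qed.

Lemma pairing_half_plane :
  pairing (\prod_i (0%:A + 1 *: (S i + T i) + 0 *: (S i * T i)) ^+ k i)
  = msum_le k (fun a => (mbinom k a)%:R *: (in_w (P a) * in_z (Q (k - a)%MM))).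
Proof.
(* In this order the expansion gives [S] the exponent [a] and [T] the exponent [k - a]. *)
transitivity (pairing (\prod_i (T i + S i) ^+ k i)).
  congr (pairing _); apply: eq_bigr => i _.
  by rewrite !scale0r add0r addr0 scale1r addrC.
rewrite prod_exprD raddf_sum; apply: eq_bigr => a ak /=.
rewrite -mpolyX_zexp -mpolyX_wexp raddfMn /= mulrC -mpolyXD.
by rewrite pairingX ?lem_subr // scaler_nat.
Qed.

Lemma pairing_disk :
  pairing (\prod_i (1%:A + 0 *: (S i + T i) + 1 *: (S i * T i)) ^+ k i)
  = msum_le k (fun a => (mbinom k a)%:R *: (in_w (P a) * in_z (Q a))).
Proof.
transitivity (pairing (\prod_i (1 + S i * T i) ^+ k i)).
  congr (pairing _); apply: eq_bigr => i _.
  by rewrite scale0r addr0 !scale1r.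
rewrite prod_exprD raddf_sum; apply: eq_bigr => a ak /=.
rewrite big1 => [|i _]; last by rewrite expr1n.
rewrite mul1r (eq_bigr _ (fun i _ => exprMn _ _ _)) big_split /=.
rewrite -mpolyX_zexp -mpolyX_wexp raddfMn /= -mpolyXD.
by rewrite pairingX // scaler_nat.
Qed.

Lemma half_plane_stable (theta : R) :
  stable (half_plane theta) f -> stable (half_plane theta) g ->
  let h := msum_le k (fun a =>
    (mbinom k a)%:R *: (in_w (P a) * in_z (Q (k - a)%MM))) in
  stable (half_plane theta) h \/ h = 0.
Proof.
move=> fs gs h; pose w := half_plane_dir theta.
have w0 : w != 0 := half_plane_dir_neq0 theta.
(* The coefficients of the contractor at [t = e w] and [s = w / e], multiplied by [l = e / w]; at
   [e = 0] they are 0, 1, 0 and leave [S + T]. *)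
have := @pairing_limit_stable _ ((2 / w) *: 'X) ('X^2 + 1) ((2 * w) *: 'X)
  (half_plane_circular theta) _ fs gs.
have -> : ((2 / w) *: 'X).[0] = 0 :> C by rewrite hornerZ hornerX mulr0.
have -> : ((2 * w) *: 'X).[0] = 0 :> C by rewrite hornerZ hornerX mulr0.
have -> : ('X^2 + 1).[0] = 1 :> C by rewrite hornerD hornerXn hornerC expr0n add0r.
rewrite pairing_half_plane -/h; apply=> e /andP[e0 _].
have en0 : e != 0 by rewrite gt_eqF.
exists (e * w), (e^-1 * w), (e / w); split.
- exact: half_plane_dirP.
- by apply: half_plane_dirP; rewrite invr_gt0.
- by rewrite mulf_neq0 ?invr_eq0.
rewrite !hornerZ hornerD hornerXn hornerX hornerC.
by split; field; rewrite ?en0 ?w0.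
Qed.

Lemma disk_stable :
  stable (@unit_disk R) f -> stable (@unit_disk R) g ->
  let h := msum_le k (fun a => (mbinom k a)%:R *: (in_w (P a) * in_z (Q a))) in
  stable (@unit_disk R) h \/ h = 0.
Proof.
move=> fs gs h.
(* The points are [t = i (1 - e)] and [s = - t], with [l = 1/2]: the middle coefficient vanishes and
   [t s = (1 - e)^2], so that [1 + S T] is left at [e = 0]. *)
have := @pairing_limit_stable _ 1 0 ((1 - 'X) ^+ 2)
  (@unit_disk_circular R) _ fs gs.
have -> : ((1 - 'X) ^+ 2).[0] = 1 :> C.
  by rewrite horner_exp hornerD hornerN hornerX hornerC subr0 expr1n.
have -> : (1 : {poly C}).[0] = 1 by rewrite hornerC.
rewrite horner0 pairing_disk -/h; apply=> e /andP[e0 e1].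
have te : `|'i%C * (1 - e)| < 1.
  rewrite normrM complexiE normCi mul1r ger0_norm ?subr_ge0 ?(ltW e1) //.
  by rewrite ltrBlDr ltrDl.
exists ('i%C * (1 - e)), (- ('i%C * (1 - e))), 2^-1; split=> //.
- by rewrite /unit_disk normrN.
- by rewrite invr_eq0 pnatr_eq0.
rewrite horner_exp hornerD hornerN hornerX horner0 hornerC; split.
- by rewrite mulVf ?pnatr_eq0.
- by rewrite subrr mulr0.
- rewrite mulrA mulKf ?pnatr_eq0 // mulrN mulrACA -expr2 sqr_i.
  by rewrite mulN1r opprK.
Qed.

End Composition.

Theorem theorem4p1 (R : realType) (n : nat) (hn : (0 < n)%N) (k : 'X_{1..n})
    (P Q : 'X_{1..n} -> {mpoly R[i][n]}) (f g : {mpoly R[i][n + n]})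
    (hf : f = msum_le k (fun a => (mbinom k a)%:R *: (in_w (P a) * 'X_[zexp a])))
    (hg : g = msum_le k (fun a => (mbinom k a)%:R *: (in_z (Q a) * 'X_[wexp a]))) :
  (let h := msum_le k (fun a =>
       (mbinom k a)%:R *: (in_w (P a) * in_z (Q (k - a)%MM))) in
   h = (mfact k)%:R^-1 *: msum_le k (fun a =>
         at_z0 (f^`M[zexp a]) * at_w0 (g^`M[wexp (k - a)%MM])) /\
   (forall theta : R, 0 <= theta < 2 * trigo.pi ->
      stable (half_plane theta) f -> stable (half_plane theta) g ->
      stable (half_plane theta) h \/ h = 0)) /\
  (let h := msum_le k (fun a =>
       (mbinom k a)%:R *: (in_w (P a) * in_z (Q a))) in
   h = (mfact k)%:R^-1 *: msum_le k (fun a =>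
         ((mfact (k - a)%MM)%:R / (mfact a)%:R) *:
           (at_z0 (f^`M[zexp a]) * at_w0 (g^`M[wexp a]))) /\
   (stable (@unit_disk R) f -> stable (@unit_disk R) g ->
      stable (@unit_disk R) h \/ h = 0)).
Proof.
subst f g; split=> h; split.
- exact: half_plane_sum_mderivm.
- by move=> theta _; apply: half_plane_stable.
- exact: disk_sum_mderivm.
- exact: disk_stable.
Qed.
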